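(* Let $H\in\mathcal N_2$ be a normal affine semigroup in $\mathbb N^2$ and let $K$ be a field. Then $R=K[H]$ is a nearly Gorenstein ring.
   Context: $\mathbb N=\{0,1,2,\dots\}$. $\mathcal N_2$ is the class of normal affine semigroups $H\subseteq\mathbb N^2$ generating $\mathbb Z^2$ as a group: $H$ is a finitely generated submonoid of $\mathbb N^2$ with $H=C\cap\mathbb Z^2$, where $C\subseteq\mathbb R^2$ is the (two-dimensional) cone generated by $H$; such $H$ is automatically simplicial. Put $\omega_H=\mathbb Z^2\cap\operatorname{relint}C$. $R=K[H]$ is the subalgebra of the polynomial ring in two variables over $K$ spanned by the monomials $\mathbf x^{\mathbf h}$, $\mathbf h\in H$; its graded maximal ideal $\mathfrak m$ is generated by $\mathbf x^{\mathbf h}$, $0\ne\mathbf h\in H$. The canonical module $\omega_R$ of the Cohen–Macaulay domain $R$ is the ideal of $R$ spanned over $K$ by the monomials $\mathbf x^{\mathbf h}$, $\mathbf h\in\omega_H$. The trace of $\omega_R$ is the ideal $\operatorname{tr}(\omega_R)=\sum_f f\omega_R$ of $R$, where the sum is over all $f$ in the quotient field of $R$ with $f\omega_R\subseteq R$. $R$ is called nearly Gorenstein if $\mathfrak m\subseteq\operatorname{tr}(\omega_R)$. *)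

(* Defs.v *)
From HB Require Import structures.
From mathcomp Require Import all_boot all_order all_algebra.
From mathcomp Require Import mpoly.
From mathcomp Require Import boolp classical_sets reals.
From mathcomp Require Import topology normedtype.

Set Implicit Arguments.
Unset Strict Implicit.
Unset Printing Implicit Defensive.

Import Order.TTheory GRing.Theory Num.Theory.
Import numFieldNormedType.Exports.

Local Open Scope classical_set_scope.
Local Open Scope ring_scope.

Section ConvexGeometry.
Variables (R : realType) (V : normedModType R).
Implicit Type A : set V.

Definition cone A : set V :=
  [set x | exists n (c : 'I_n -> R) (a : 'I_n -> V),
     (forall i, 0 <= c i /\ A (a i)) /\ x = \sum_(i < n) c i *: a i].

Definition affine_hull A : set V :=
  [set x | exists n (c : 'I_n -> R) (a : 'I_n -> V),
     [/\ forall i, A (a i), \sum_(i < n) c i = 1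
       & x = \sum_(i < n) c i *: a i]].

(* Interior relative to the affine hull: [within D (nbhs x)] is the trace on [D]
   of the neighbourhood filter of [x].                                        *)
Definition relint A : set V :=
  [set x | A x /\ within (affine_hull A) (nbhs x) A].

End ConvexGeometry.

(* N^n is the type 'X_{1..n} of exponents of monomials, Z^n is 'rV[int]_n and
   R^n is 'rV[R]_n.                                                           *)
Section AffineSemigroup.
Variables (R : realType) (n : nat).
Implicit Type H : set 'X_{1..n}.

Definition NtoZ (h : 'X_{1..n}) : 'rV[int]_n := \row_i (h i)%:Z.

Definition ZtoR (z : 'rV[int]_n) : 'rV[R]_n := map_mx intr z.

Definition submonoid H : Prop :=
  H 0%MM /\ forall g h, H g -> H h -> H (g + h)%MM.

Definition affine_semigroup H : Prop :=
  exists s : seq 'X_{1..n}, H = smallest submonoid [set` s].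

Definition subgroupZ (G : set 'rV[int]_n) : Prop :=
  G 0 /\ forall x y, G x -> G y -> G (x - y).

Definition semigroup_cone H : set 'rV[R]_n := cone ((ZtoR \o NtoZ) @` H).

Definition normal_semigroup H : Prop :=
  NtoZ @` H = ZtoR @^-1` semigroup_cone H.

Definition omegaH H : set 'rV[int]_n := ZtoR @^-1` relint (semigroup_cone H).

Definition class_N H : Prop :=
  [/\ affine_semigroup H, smallest subgroupZ (NtoZ @` H) = setT
    & normal_semigroup H].

End AffineSemigroup.

Local Notation "x %:F" := (@tofrac _ x).

Section Trace.
Variable S : idomainType.
Implicit Types A I G : set S.

(* [A] is meant to be a subring of [S], and its quotient field is realised
   inside that of [S].                                                        *)
Definition quotient_field A : set {fraction S} :=
  [set f | exists a b, [/\ A a, A b, b != 0 & f = a%:F / b%:F]].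

Definition ideal_generated A G : set S :=
  [set x | exists n (a g : 'I_n -> S),
     (forall i, A (a i) /\ G (g i)) /\ x = \sum_(i < n) a i * g i].

Definition multiplier A I (f : {fraction S}) : Prop :=
  quotient_field A f /\ [set f * w%:F | w in I] `<=` @tofrac S @` A.

Definition trace A I : set S :=
  [set x | exists n (f : 'I_n -> {fraction S}) (w : 'I_n -> S),
     (forall i, multiplier A I (f i) /\ I (w i)) /\
     x%:F = \sum_(i < n) f i * (w i)%:F].

End Trace.

Section SemigroupRing.
Variables (R : realType) (K : fieldType) (n : nat).
Implicit Type H : set 'X_{1..n}.

Definition monomial_span (M : set 'X_{1..n}) : set {mpoly K[n]} :=
  [set p | exists (s : seq 'X_{1..n}) (c : 'X_{1..n} -> K),
     [set` s] `<=` M /\ p = \sum_(h <- s) c h *: 'X_[h]].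

Definition semigroup_ring H : set {mpoly K[n]} := monomial_span H.

Definition graded_max_ideal H : set {mpoly K[n]} :=
  ideal_generated (semigroup_ring H)
    [set 'X_[h] | h in [set h | H h /\ h <> 0%MM]].

(* The cone of [H] lies in the nonnegative orthant, hence [omegaH] lies in N^n
   and nothing is lost by taking its preimage in N^n.                         *)
Definition canonical_module H : set {mpoly K[n]} :=
  monomial_span (@NtoZ n @^-1` omegaH R H).

Definition nearly_gorenstein H : Prop :=
  graded_max_ideal H `<=` trace (semigroup_ring H) (canonical_module H).

End SemigroupRing.

(* Main.v *)
(* Let u and v be generators of H of extreme slope, so that the cone of H is the
   wedge det(u, z) >= 0, det(z, v) >= 0 and omega_H consists of the lattice
   points where both determinants are positive.  It suffices to find, for every
   nonzero h in H, some w in omega_H with h - w + omega_H contained in H: then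
   X^h / X^w multiplies omega_R into R, and X^h = (X^h / X^w) X^w is in the trace.
   If h is interior, w = h works.  If h lies on the face det(u, h) = 0, take w
   with det(u, w) the least positive value of det(u, _) and reduce det(w, v)
   modulo det(h, v) by adding multiples of h, so that 1 <= det(w, v) <= det(h, v). *)
From HB Require Import structures.
Require Import Defs.
From mathcomp Require Import all_boot all_order all_algebra.
From mathcomp Require Import mpoly.
From mathcomp Require Import boolp classical_sets reals.
From mathcomp Require Import topology normedtype.
From mathcomp Require Import ring lra zify.

Set Implicit Arguments.
Unset Strict Implicit.
Unset Printing Implicit Defensive.

Import Order.TTheory GRing.Theory Num.Theory.
Import numFieldNormedType.Exports.

Local Open Scope classical_set_scope.
Local Open Scope ring_scope.

Local Notation "x %:F" := (@tofrac _ x).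

(** * Splitting a lattice point along two additive forms *)

Section LatticePoints.
Variables (V : zmodType) (D1 D2 : V -> int).
Hypotheses (D1B : zmod_morphism D1) (D2B : zmod_morphism D2).

Lemma zmod_morphismD (D : V -> int) x y :
  zmod_morphism D -> D (x + y) = D x + D y.
Proof.
move=> DB; have := DB 0 0; rewrite !subrr => D0.
by have := DB 0 y; have := DB x (- y); rewrite opprK sub0r D0 => -> ->; ring.
Qed.

Lemma zmod_morphismMz (D : V -> int) x (k : int) :
  zmod_morphism D -> D (x *~ k) = k * D x.
Proof.
move=> DB; have := DB 0 0; rewrite !subrr => D0.
elim: k => [|n IH|n IH]; first by rewrite mulr0z D0 mul0r.
  by rewrite intS mulrzDr zmod_morphismD // IH; ring.
by rewrite intS opprD mulrzDr mulrNz mulr1z addrC DB IH; ring.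
Qed.

Lemma min_positive_value (D : V -> int) : (exists z, 0 < D z) ->
  exists2 z, 0 < D z & forall y, 0 < D y -> D z <= D y.
Proof.
move=> [z0 z0P].
pose P (n : nat) := `[< exists2 z, D z = n%:Z & 0 < D z >].
have exP : exists n, P n by exists `|D z0|%N; apply/asboolP; exists z0; lia.
case: (ex_minnP exP) => m /asboolP[z Dz z_gt0] minm.
exists z => // y y_gt0.
have /minm : P `|D y|%N by apply/asboolP; exists y; lia.
lia.
Qed.

(* If [omega_H] is the set of points where [D1] and [D2] are positive, then [w]
   lies in [omega_H] and [h - w] in its inverse. *)
Definition splits (h w : V) := [/\ 0 < D1 w, 0 < D2 w &
  forall y, 0 < D1 y -> 0 < D2 y -> 0 <= D1 (h - w + y) /\ 0 <= D2 (h - w + y)].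

(* [D1] takes its least positive value at some [z], and adding multiples of [h]
   to [z] reduces [D2 z] modulo [D2 h] without changing [D1 z]. *)
Lemma exists_splits_face (h : V) : (exists z, 0 < D1 z) ->
  D1 h = 0 -> 0 < D2 h -> exists w, splits h w.
Proof.
move=> /min_positive_value[z z_gt0 minz] D1h D2h.
(* The shift by 1 makes the reduced value of [D2] range from 1 to [D2 h] instead of 0 to [D2 h - 1]:
   it stays positive and does not exceed [D2 h]. *)
pose k := ((D2 z - 1) %/ D2 h)%Z.
have D1w : D1 (z - h *~ k) = D1 z.
  by rewrite D1B zmod_morphismMz // D1h mulr0 subr0.
have D2w : D2 (z - h *~ k) = ((D2 z - 1) %% D2 h)%Z + 1.
  by rewrite D2B zmod_morphismMz // /k; have := divz_eq (D2 z - 1) (D2 h); lia.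
have r_ge0 : 0 <= ((D2 z - 1) %% D2 h)%Z by rewrite modz_ge0 ?gt_eqF.
have r_lt : ((D2 z - 1) %% D2 h)%Z < D2 h by rewrite ltz_pmod.
exists (z - h *~ k); split; [by rewrite D1w | by rewrite D2w; lia |].
move=> y /minz D1y D2y.
rewrite (zmod_morphismD _ _ D1B) (zmod_morphismD _ _ D2B) D1B D2B D1w D2w D1h.
by split; lia.
Qed.

End LatticePoints.

(** At most one of [D1 h] and [D2 h] vanishes. The two face cases are exchanged by swapping the
    forms; off both faces [w := h] leaves [h - w + y = y]. *)
Lemma exists_splits (V : zmodType) (D1 D2 : V -> int) (h : V) :
    zmod_morphism D1 -> zmod_morphism D2 ->
    (exists z, 0 < D1 z) -> (exists z, 0 < D2 z) ->
    0 <= D1 h -> 0 <= D2 h -> (D1 h != 0) || (D2 h != 0) ->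
  exists w, splits D1 D2 h w.
Proof.
move=> D1B D2B D1_gt0 D2_gt0 D1h D2h h_neq0.
have [D1h0|D1h_neq0] := eqVneq (D1 h) 0.
  by apply: exists_splits_face => //; lia.
have [D2h0|D2h_neq0] := eqVneq (D2 h) 0.
  have [|w [w1 w2 wP]] := exists_splits_face D2B D1B D2_gt0 D2h0; first lia.
  by exists w; split=> // y y1 y2; case: (wP y).
exists h; split; [lia|lia|] => y y1 y2.
by rewrite subrr add0r; split; exact: ltW.
Qed.

(** * Planar determinants as linear forms *)

Section Det2.
Variable A : comNzRingType.
Implicit Types x y z : 'rV[A]_2.

Definition det2 x y := x 0 0 * y 0 1 - x 0 1 * y 0 0.

Lemma det2_is_zmod_morphism x : zmod_morphism (det2 x).
Proof. by move=> y z; rewrite /det2 !mxE; ring. Qed.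

HB.instance Definition _ x :=
  GRing.isZmodMorphism.Build 'rV[A]_2 A (det2 x) (det2_is_zmod_morphism x).

Lemma det2Br x y z : det2 x (y - z) = det2 x y - det2 x z.
Proof. exact: raddfB. Qed.

Lemma det2Dr x y z : det2 x (y + z) = det2 x y + det2 x z.
Proof. exact: raddfD. Qed.

Lemma det2Dl x y z : det2 (x + y) z = det2 x z + det2 y z.
Proof. by rewrite /det2 !mxE; ring. Qed.

Lemma det20r x : det2 x 0 = 0.
Proof. exact: raddf0. Qed.

Lemma det20l x : det2 0 x = 0.
Proof. by rewrite /det2 !mxE; ring. Qed.

Lemma det2Zr x a y : det2 x (a *: y) = a * det2 x y.
Proof. by rewrite /det2 !mxE; ring. Qed.

Lemma det2C x y : det2 x y = - det2 y x.
Proof. by rewrite /det2; ring. Qed.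

Lemma det2Nl x y : det2 (- x) y = det2 y x.
Proof. by rewrite /det2 !mxE; ring. Qed.

Lemma det2xx x : det2 x x = 0.
Proof. by rewrite /det2; ring. Qed.

Lemma row2P x y : x 0 0 = y 0 0 -> x 0 1 = y 0 1 -> x = y.
Proof.
move=> e0 e1; apply/rowP => i.
by have /orP[/eqP->|/eqP->] : (i == 0) || (i == 1) by case: i => [[|[]]].
Qed.

(** Cramer's rule with the denominator cleared, so that it applies to integer vectors as well as
    real ones. *)
Lemma cramer2 x y z : det2 x y *: z = det2 z y *: x + det2 x z *: y.
Proof. by apply: row2P; rewrite /det2 !mxE; ring. Qed.

Lemma det2_eq0 x : (forall y, det2 x y = 0) -> x = 0.
Proof.
move=> x0; have := x0 (delta_mx 0 0); have := x0 (delta_mx 0 1).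
rewrite /det2 !mxE /= => e0 e1; apply: row2P; rewrite mxE.
  by rewrite -e0; ring.
by apply: oppr_inj; rewrite oppr0 -e1; ring.
Qed.

End Det2.

(** * Wedges as cones, and their relative interior *)

Definition wedge (R : numDomainType) (x y : 'rV[R]_2) : set 'rV[R]_2 :=
  [set z | 0 <= det2 x z /\ 0 <= det2 z y].

Section RealWedge.
Variables (R : realType) (x y : 'rV[R]_2).

(** The determinants are linear, so their signs pass from [A] to its cone. Conversely, Cramer's rule
    writes a point of the wedge as a nonnegative combination of [x] and [y] alone. *)
Lemma cone_wedge (A : set 'rV[R]_2) :
  0 < det2 x y -> A x -> A y -> A `<=` wedge x y -> cone A = wedge x y.
Proof.
move=> xy_gt0 Ax Ay Asub; apply/seteqP; split=> z /=.
  move=> [n [c [a [ca ->]]]]; split.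
    rewrite raddf_sum /=; apply: sumr_ge0 => i _; have [ci /Asub[ai _]] := ca i.
    by rewrite det2Zr mulr_ge0.
  rewrite det2C raddf_sum -sumrN /=; apply: sumr_ge0 => i _.
  have [ci /Asub[_ ai]] := ca i.
  by rewrite det2Zr -mulrN -det2C mulr_ge0.
move=> [xz zy]; exists 2%N.
exists (fun i => (if i == 0 then det2 z y else det2 x z) / det2 x y).
exists (fun i => if i == 0 then x else y); split.
  by move=> i; split; case: ifP => // _; rewrite divr_ge0 // ltW.
rewrite !big_ord_recl big_ord0 /= addr0 ![_ / _]mulrC -!scalerA -scalerDr.
by rewrite -cramer2 scalerA mulVf ?scale1r // gt_eqF.
Qed.

Lemma det2_continuous : continuous (det2 x).
Proof.
move=> z; have c i : (y : 'rV[R]_2) 0 i @[y --> z] --> z 0 i.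
  exact: coord_continuous.
exact: (cvgB (cvgM (cvg_cst (x 0 0)) (c 1)) (cvgM (cvg_cst (x 0 1)) (c 0))).
Qed.

End RealWedge.

Lemma relint_wedge (R : realType) (x y : 'rV[R]_2) : 0 < det2 x y ->
  relint (wedge x y) = [set z | 0 < det2 x z /\ 0 < det2 z y].
Proof.
move=> xy_gt0; apply/seteqP; split=> z /=; last first.
  move=> [xz zy]; split; first by split; exact: ltW.
  have pos_near (t : 'rV[R]_2) : 0 < det2 t z -> \forall s \near z, 0 < det2 t s.
    exact: cvgr_gt (@det2_continuous R t z) 0.
  (* Moving the variable to the second slot lets [pos_near] serve both conditions. *)
  rewrite -det2Nl in zy.
  apply: filterS2 (pos_near _ xz) (pos_near _ zy) => s xs sy _.
  by split; [exact: ltW | rewrite -det2Nl ltW].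
move=> [[xz zy] Wz].
(* Moving from [z] along [- (x + y)] stays in the affine hull, hence in the
   wedge, for a while. *)
have ztoz : z - t *: (x + y) @[t --> 0^'+] --> z.
  rewrite -[X in _ --> X]subr0 -(scale0r (x + y)).
  apply: cvgB; first exact: cvg_cst.
  by apply: cvgZ; [exact: cvg_at_right_filter | exact: cvg_cst].
have [t [t_gt0 Wt]] := filter_ex (filterI (nbhs_right_gt 0) (ztoz _ Wz)).
have [] : wedge x y (z - t *: (x + y)).
  apply: Wt; exists 3%N.
  (* The origin, a point of the wedge, takes the coefficient [t] to bring the sum of coefficients
     back to 1. *)
  exists (fun i => if i == 0 then 1 else if i == 1 then - t else t).
  exists (fun i => if i == 0 then z else if i == 1 then x + y else 0).
  split; last 2 first.
  - by rewrite !big_ord_recl big_ord0 /=; ring.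
  - by rewrite !big_ord_recl big_ord0 /= scale1r scaler0 !addr0 scaleNr.
  move=> i; case: ifP => // _; case: ifP => // _; rewrite /wedge /=.
    rewrite det2Dr det2Dl !det2xx add0r addr0.
    by split; exact: ltW.
  by rewrite det20r det20l.
have -> : det2 x (z - t *: (x + y)) = det2 x z - t * det2 x y.
  by rewrite /det2 !mxE; ring.
have -> : det2 (z - t *: (x + y)) y = det2 z y - t * det2 x y.
  by rewrite /det2 !mxE; ring.
by have := mulr_gt0 t_gt0 xy_gt0; split; lra.
Qed.

(** * Generators of extreme slope *)

Lemma sorted_min (T : eqType) (r : rel T) (s : seq T) :
    s != [::] -> {in s &, total r} -> {in s & &, transitive r} ->
  exists2 x, x \in s & {in s, forall y, r x y}.
Proof.
move=> s0 r_total r_trans.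
have := sort_sorted_in r_total (introT allP (fun x => id)).
case E: (sort r s) (mem_sort r s) => [|x t] mem_xt /= r_path.
  by case: s E s0 {r_total r_trans mem_xt} => // a s /(congr1 size); rewrite size_sort.
have xs : x \in s by rewrite -mem_xt mem_head.
exists x => // y; rewrite -mem_xt inE => /predU1P[->|yt].
  by have := r_total x x xs xs; rewrite orbb.
have /allP : all (r x) t; last exact.
by apply: (order_path_min_in r_trans _ r_path); apply/allP => a; rewrite mem_xt.
Qed.

Lemma NtoZD n (g h : 'X_{1..n}) : NtoZ (g + h)%MM = NtoZ g + NtoZ h.
Proof. by apply/rowP => i; rewrite !mxE mnmDE PoszD. Qed.

Lemma NtoZ_inj n : injective (@NtoZ n).
Proof. by move=> g h /rowP e; apply/mnmP => i; have := e i; rewrite !mxE => -[]. Qed.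

Lemma NtoZ0 n : NtoZ (0%MM : 'X_{1..n}) = 0.
Proof. by apply/rowP => i; rewrite !mxE mnm0E. Qed.

Lemma det2_ZtoR (R : realType) (x y : 'rV[int]_2) :
  det2 (ZtoR R x) (ZtoR R y) = (det2 x y)%:~R.
Proof. by rewrite /det2 !mxE rmorphB !rmorphM. Qed.

Section Plane.
Variables (H : set 'X_{1..2}).
Implicit Types g h k : 'X_{1..2}.

(** By Cramer's rule [det2 g k *: h = det2 h k *: g + det2 g h *: k]. Coordinates are natural
    numbers, so if [det2 g k < 0] the left side is nonpositive and the right side nonnegative, which
    forces [h = 0]. *)
Lemma det2_trans g h k : h != 0%MM -> 0 <= det2 (NtoZ g) (NtoZ h) ->
  0 <= det2 (NtoZ h) (NtoZ k) -> 0 <= det2 (NtoZ g) (NtoZ k).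
Proof.
move=> h0 gh hk; have e := cramer2 (NtoZ g) (NtoZ k) (NtoZ h).
have e0 := congr1 (fun x : 'rV[int]_2 => x 0 0) e.
have e1 := congr1 (fun x : 'rV[int]_2 => x 0 1) e.
apply: contraNT h0; rewrite -ltNge => gk.
move: gh hk gk e0 e1; rewrite !mxE.
move: (det2 (NtoZ g) (NtoZ h)) (det2 (NtoZ h) (NtoZ k)) (det2 (NtoZ g) (NtoZ k)).
move=> a b d a0 b0 d0 e0 e1; apply/eqP/mnmP => i; rewrite mnm0E.
have /orP[/eqP->|/eqP->] : (i == 0) || (i == 1) by case: i => [[|[]]].
  by nia.
by nia.
Qed.

(** The kernel of [det2 x] is a subgroup, so vanishing on the generators spreads to [H] and then to
    the whole lattice. *)
Lemma det2_span (s : seq 'X_{1..2}) (x : 'rV[int]_2) :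
    H = smallest (@submonoid 2) [set` s] ->
    smallest (@subgroupZ 2) (@NtoZ 2 @` H) = setT ->
  {in s, forall h, det2 x (NtoZ h) = 0} -> x = 0.
Proof.
move=> HE HT xs; apply: det2_eq0 => y; have : [set: 'rV[int]_2] y by [].
rewrite -HT; apply: (smallest_sub (X := [set z | det2 x z = 0])).
  by split=> [|? ? /= e1 e2]; rewrite /= ?det20r // det2Br e1 e2 subrr.
move=> _ [h Hh <-]; rewrite HE in Hh.
apply: (smallest_sub (X := [set h | det2 x (NtoZ h) = 0])) Hh => //.
by split=> [|? ? /= e1 e2]; rewrite /= ?NtoZ0 ?det20r // NtoZD det2Dr e1 e2 addr0.
Qed.

Lemma exists_extreme : affine_semigroup H ->
    smallest (@subgroupZ 2) (@NtoZ 2 @` H) = setT ->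
  exists g h, [/\ H g, H h, 0 < det2 (NtoZ g) (NtoZ h) &
    forall k, H k -> wedge (NtoZ g) (NtoZ h) (NtoZ k)].
Proof.
(* Zero has determinant 0 with every vector and would break the transitivity of the slope order. *)
move=> [s HE] HT; pose t := [seq h <- s | h != 0%MM].
have tH h : h \in t -> H h.
  by rewrite HE mem_filter => /andP[_ hs]; apply: sub_gen_smallest.
have t_neq0 h : h \in t -> h != 0%MM by rewrite mem_filter => /andP[].
have t_span x : {in t, forall h, det2 x (NtoZ h) = 0} -> x = 0.
  move=> xt; apply: (det2_span HE HT) => h hs.
  have [->|h0] := eqVneq h 0%MM; first by rewrite NtoZ0 det20r.
  by rewrite xt // mem_filter h0.
have t0 : t != [::].
  apply/eqP => tE; have/rowP/(_ 0) : const_mx 1 = 0 :> 'rV[int]_2.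
    by apply: t_span => h; rewrite tE.
  by rewrite !mxE.
pose r g h := 0 <= det2 (NtoZ g) (NtoZ h).
have r_total : total r.
  by move=> g h; rewrite /r (det2C (NtoZ h)) oppr_ge0; exact: le_total.
have r_trans : {in t & &, transitive r}.
  by move=> h g k ht _ _; apply: det2_trans; exact: t_neq0.
have [g gt gmin] := sorted_min t0 (in2W r_total) r_trans.
have [h ht hmax] : exists2 h, h \in t & {in t, forall g, r g h}.
  apply: (@sorted_min _ (fun g h => r h g)) t0 _ _.
    by move=> a b _ _; exact: r_total.
  by move=> b a c bt at_ ct ab bc; exact: r_trans bc ab.
have H_wedge : forall k, H k -> wedge (NtoZ g) (NtoZ h) (NtoZ k).
  pose W : set 'X_{1..2} := [set k | wedge (NtoZ g) (NtoZ h) (NtoZ k)].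
  move=> k; rewrite HE; apply: (smallest_sub (X := W)).
    split=> [|a b /= [a1 a2] [b1 b2]]; rewrite /W /wedge /=.
      by rewrite NtoZ0 det20r det20l.
    by rewrite NtoZD det2Dr det2Dl; split; exact: addr_ge0.
  move=> {}k /= ks; rewrite /W /wedge /=; have [->|k0] := eqVneq k 0%MM.
    by rewrite NtoZ0 det20r det20l.
  have kt : k \in t by rewrite mem_filter k0.
  by split; [exact: gmin | exact: hmax].
exists g, h; split; [exact: tH|exact: tH| |exact: H_wedge].
(* If the extreme slopes agreed, every generator would be parallel to [g]; as the generators span
   the lattice, [g] would be 0. *)
rewrite lt_neqAle [_ <= _]gmin // andbT eq_sym; apply/negP => /eqP gh0.
have /eqP := t_neq0 g gt; apply; apply: (@NtoZ_inj 2); rewrite NtoZ0.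
apply: t_span => k kt; apply: le_anti; rewrite [_ <= det2 _ _]gmin // andbT.
rewrite det2C oppr_le0; apply: (det2_trans (t_neq0 h ht)); first exact: hmax.
by rewrite det2C gh0 oppr0.
Qed.

End Plane.

(** * Monomial spans and the trace ideal *)

Lemma mpolyX_neq0 (R : nzRingType) n (h : 'X_{1..n}) :
  'X_[h] != 0 :> {mpoly R[n]}.
Proof. by rewrite -msupp_eq0 msuppX. Qed.

Section SemigroupRing.
Variables (K : fieldType) (n : nat).
Implicit Types (M H : set 'X_{1..n}) (p q : {mpoly K[n]}).

Lemma monomial_spanP M p : monomial_span M p <-> {in msupp p, forall h, M h}.
Proof.
split=> [[s [c [sM ->]]] h|pM].
  move=> /msupp_sum_le/flatten_mapP[g]; rewrite mem_filter => /andP[_ gs].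
  by move=> /msuppZ_le; rewrite msuppX inE => /eqP->; exact: sM.
by exists (msupp p), (fun h => p@_h); split; [exact: pM | exact: mpolyE].
Qed.

Lemma monomial_spanX M h : M h -> @monomial_span K n M 'X_[h].
Proof. by move=> Mh; apply/monomial_spanP => g; rewrite msuppX inE => /eqP->. Qed.

Lemma monomial_spanM M p q : submonoid M ->
  monomial_span M p -> monomial_span M q -> monomial_span M (p * q).
Proof.
move=> [_ MD] /monomial_spanP pM /monomial_spanP qM; apply/monomial_spanP => h.
move=> /msuppM_le/allpairsP[[g k] /= [gp kq ->]].
by apply: MD; [exact: pM|exact: qM].
Qed.

(** Each term [a * X^h] is the multiplier [a * X^h / X^w] applied to [X^w]. The equation
    [g + w = h + y] states that [h - w + y] lies in [H] without subtracting exponents. *)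
Lemma nearly_gorenstein_of_split (R : realType) H : submonoid H ->
    (forall h, H h -> h <> 0%MM -> exists2 w, H w /\ omegaH R H (NtoZ w) &
      forall y, omegaH R H (NtoZ y) -> exists2 g, H g & (g + w = h + y)%MM) ->
  nearly_gorenstein R K H.
Proof.
move=> Hm split_H p [m [a [x [ax ->]]]].
have fw i : exists fw : {fraction {mpoly K[n]}} * {mpoly K[n]},
    [/\ multiplier (@semigroup_ring K n H) (@canonical_module R K n H) fw.1,
        @canonical_module R K n H fw.2 & fw.1 * fw.2%:F = (a i * x i)%:F].
  have [Aa [h [Hh h0] <-]] := ax i.
  have [w [Hw ww] wP] := split_H h Hh h0.
  have Xw0 : ('X_[w] : {mpoly K[n]})%:F != 0 by rewrite tofrac_eq0 mpolyX_neq0.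
  exists ((a i * 'X_[h])%:F / 'X_[w]%:F, 'X_[w]); split=> /=;
    last by rewrite divfK.
    split.
      exists (a i * 'X_[h]), 'X_[w]; split=> //; last by exact: mpolyX_neq0.
        by apply: monomial_spanM => //; exact: monomial_spanX.
      exact: monomial_spanX.
    move=> _ [q /monomial_spanP qI <-].
    (* Subtraction of exponents is truncated, but exact here because [h + y = g + w]. *)
    exists (a i * \sum_(y <- msupp q) q@_y *: 'X_[(h + y - w)%MM]).
      apply: monomial_spanM => //.
      apply/monomial_spanP => k /msupp_sum_le/flatten_mapP[y].
      rewrite mem_filter => /andP[_ yq] /msuppZ_le; rewrite msuppX inE => /eqP->.
      by have [g Hg gE] := wP y (qI y yq); rewrite -gE addmK.
    apply: (mulIf Xw0); rewrite mulrAC divfK // -!tofracM -!mulrA.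
    congr (_ * _)%:F.
    rewrite [q in RHS]mpolyE mulr_suml mulr_sumr; apply: eq_big_seq => y yq.
    have [g _ gE] := wP y (qI y yq).
    by rewrite -gE addmK -scalerAl -scalerAr -!mpolyXD gE.
  exact: monomial_spanX.
have [f fP] := choice fw.
exists m, (fun i => (f i).1), (fun i => (f i).2); split.
  by move=> i; have [] := fP i.
by rewrite raddf_sum; apply: eq_bigr => i _; have [_ _ e] := fP i; rewrite /= e.
Qed.

End SemigroupRing.

Theorem theorem7p1 (R : realType) (K : fieldType) (H : set 'X_{1..2})
    (HN : class_N R H) :
  nearly_gorenstein R K H.
Proof.
have [Haff HT Hnorm] := HN.
have [u [v [Hu Hv uv_gt0 Huv]]] := exists_extreme Haff HT.
have uvR : 0 < det2 (ZtoR R (NtoZ u)) (ZtoR R (NtoZ v)).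
  by rewrite det2_ZtoR ltr0z.
have coneE :
    semigroup_cone (R := R) H = wedge (ZtoR R (NtoZ u)) (ZtoR R (NtoZ v)).
  apply: cone_wedge => //; [by exists u | by exists v |].
  move=> _ [h Hh <-]; have [h1 h2] := Huv h Hh.
  by split; rewrite det2_ZtoR ler0z.
(* Normality turns membership in [H] into two integer inequalities. *)
have HE z : (NtoZ (n := 2) @` H) z <-> wedge (NtoZ u) (NtoZ v) z.
  by rewrite Hnorm /preimage /= coneE /wedge /= !det2_ZtoR !ler0z.
have omegaE z : omegaH R H z <-> 0 < det2 (NtoZ u) z /\ 0 < det2 z (NtoZ v).
  by rewrite /omegaH coneE relint_wedge //= !det2_ZtoR !ltr0z.
have Hm : submonoid H.
  have [s ->] := Haff; split=> [G [[]]//|g h gH hH G GP].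
  by have [[_ GD] _] := GP; apply: GD; [exact: gH | exact: hH].
apply: nearly_gorenstein_of_split => // h Hh /eqP h0; have [h1 h2] := Huv h Hh.
(* The second form is written [det2 (- v)] to be additive in its right argument. *)
have detN z : det2 (- NtoZ v) z = det2 z (NtoZ v) by rewrite det2Nl.
have [|||||||w [w1 w2 wP]] :=
  @exists_splits _ (det2 (NtoZ u)) (det2 (- NtoZ v)) (NtoZ h).
- exact: det2_is_zmod_morphism.
- exact: det2_is_zmod_morphism.
- by exists (NtoZ v).
- by exists (NtoZ u); rewrite detN.
- exact: h1.
- by rewrite detN.
(* If both forms vanished at [h], Cramer's rule would give [det2 u v *: h = 0] with
   [det2 u v > 0]. *)
- apply: contraR h0; rewrite negb_or !negbK detN => /andP[/eqP uh0 /eqP hv0].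
  have := cramer2 (NtoZ u) (NtoZ v) (NtoZ h); rewrite uh0 hv0 !scale0r addr0.
  move=> /rowP e; apply/eqP/(@NtoZ_inj 2)/rowP => i; have /eqP := e i.
  rewrite mxE [X in _ == X]mxE mulf_eq0 gt_eqF //= NtoZ0 => /eqP->.
  by rewrite mxE.
rewrite !detN in w2 wP.
have [w' Hw' w'E] : (NtoZ (n := 2) @` H) w by apply/HE; split; exact: ltW.
exists w'; first by split=> //; apply/omegaE; rewrite w'E.
move=> y /omegaE[y1 y2].
have [g Hg gE] : (NtoZ (n := 2) @` H) (NtoZ h - w + NtoZ y).
  by apply/HE; have := wP _ y1; rewrite !detN; apply.
exists g => //; apply: (@NtoZ_inj 2); rewrite !NtoZD gE w'E.
by rewrite addrAC subrK.
Qed.
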